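(* Consider the binary signal-plus-noise model trained with the logit-regularized loss with strength $\alpha\in(0,1)$ (model and loss as defined in the context). Let $\lambda=d/N<1$ and fix $\sigma_f\ge 0$ and $\mu_f>0$. Then the optimal generalization accuracy $\mathcal{A}^{\min}_{\mathrm{gen}}$ is independent of $\sigma_n$: almost surely over the underlying standardized training noise, $\mathcal{A}^{\min}_{\mathrm{gen}}$, viewed as a function of $\sigma_n\in(0,\infty)$ for that noise realization, is constant.
   Context: Data model: a sample with label $y\in\{-1,+1\}$ is $\boldsymbol{x}=y\mu_f\boldsymbol{e}_1+\sigma_f\xi_f\boldsymbol{e}_1+\sigma_n\boldsymbol{\xi}_\perp\in\mathbb{R}^d$, where $\boldsymbol{e}_1$ is the first standard basis vector, $\xi_f\sim\mathcal{N}(0,1)$, and $\boldsymbol{\xi}_\perp$ is an independent standard Gaussian vector in $\boldsymbol{e}_1^\perp$ (first coordinate zero, remaining $d-1$ coordinates i.i.d. $\mathcal{N}(0,1)$), independent of $y$. The training set consists of $N$ samples $(\boldsymbol{x}_i,y_i)$ with independent standardized noises $(\xi_{f,i},\boldsymbol{\xi}_{\perp,i})$; changing $\sigma_n$ means rescaling while keeping these standardized noises and labels fixed. Loss: for $\boldsymbol{S}\in\mathbb{R}^d$, $$\mathcal{L}(\boldsymbol{S})=\frac1N\sum_{i=1}^N\ell(y_i\boldsymbol{S}^\top\boldsymbol{x}_i),\qquad \ell(z)=(1-\alpha)\log(1+e^{-z})+\alpha f(z),$$ where $f:\mathbb{R}\to\mathbb{R}$ is a convex and even function (the logit regularizer)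 such that $\ell$ has a unique finite global minimizer $z^*$. $\mathcal{A}^{\min}_{\mathrm{gen}}=\mathbb{P}(y\,\boldsymbol{S}_{\min}^\top\boldsymbol{x}>0)$, where $\boldsymbol{S}_{\min}$ is the minimizer of $\mathcal{L}$ over $\mathbb{R}^d$ (which is almost surely unique when $d<N$) and the probability is over a fresh sample $(\boldsymbol{x},y)$ from the data model with the same parameters $\mu_f,\sigma_f,\sigma_n$. *)

(* Defs.v *)
From mathcomp Require Import all_boot all_order all_algebra.
From mathcomp Require Import all_classical all_reals all_analysis.
Import Order.TTheory GRing.Theory Num.Theory.
Import numFieldNormedType.Exports.

Set Implicit Arguments.
Unset Strict Implicit.
Unset Printing Implicit Defensive.

Local Open Scope classical_set_scope.
Local Open Scope ring_scope.

(* The law is compared on measurable sets only: off the sigma-algebra the values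
   of [P] and [normal_prob] are artefacts of their definitions. *)
Definition std_normal d (T : measurableType d) (R : realType)
    (P : probability T R) (X : {RV P >-> R}) : Prop :=
  forall A : set R, measurable A -> distribution P X A = normal_prob 0 1 A.

(* The product rule for the subfamilies of a finite family is the case where
   some of the [A i] are [setT]. *)
Definition mutually_independent d (T : measurableType d) (R : realType)
    (P : probability T R) (I : finType) (X : I -> {RV P >-> R}) : Prop :=
  forall A : I -> set R, (forall i, measurable (A i)) ->
    P [set w | forall i, A i (X i w)] = (\prod_i P (X i @^-1` A i))%E.

(* The dimension is n.+1, so that e_1 exists; vectors orthogonal to e_1 have n
   free coordinates. A draw consists of the label and the standardized noise of
   one sample. *)
Record draw d (T : measurableType d) (R : realType) (P : probability T R)
    (n : nat) := Draw {
  label : {RV P >-> R};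
  feat_noise : {RV P >-> R};
  perp_noise : 'I_n -> {RV P >-> R} }.

Definition draw_var d (T : measurableType d) (R : realType)
    (P : probability T R) (n : nat) (D : draw P n) (k : bool + 'I_n) :
    {RV P >-> R} :=
  match k with
  | inl true => label D
  | inl false => feat_noise D
  | inr j => perp_noise D j
  end.

(* The law of the labels on {-1, +1} is left arbitrary; it may be a Dirac mass,
   so that deterministic labels are covered. *)
Definition model_draws d (T : measurableType d) (R : realType)
    (P : probability T R) (n : nat) (I : finType) (D : I -> draw P n) : Prop :=
  [/\ forall i w, label (D i) w = 1 \/ label (D i) w = - 1,
      forall i, std_normal (feat_noise (D i)),
      forall i j, std_normal (perp_noise (D i) j) &
      mutually_independent (fun ik : I * (bool + 'I_n) =>
        draw_var (D ik.1) ik.2)].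

Section Sample.
Variables (d : measure_display) (T : measurableType d) (R : realType).
Variables (P : probability T R) (n : nat).

Definition e1 : 'cV[R]_n.+1 := delta_mx 0 0.

Definition xi_perp (D : draw P n) (w : T) : 'cV[R]_n.+1 :=
  \col_(k < n.+1) oapp (fun j => perp_noise D j w) 0 (unlift ord0 k).

Definition sample (muf sigmaf sigman : R) (D : draw P n) (w : T) :
    'cV[R]_n.+1 :=
  (label D w * muf) *: e1 + (sigmaf * feat_noise D w) *: e1
  + sigman *: xi_perp D w.

Definition dotp (S x : 'cV[R]_n.+1) : R := (S^T *m x) 0 0.

Definition accuracy (muf sigmaf sigman : R) (D : draw P n) (S : 'cV[R]_n.+1) :
    \bar R :=
  P [set w | 0 < label D w * dotp S (sample muf sigmaf sigman D w)].

End Sample.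

Definition ell (R : realType) (alpha : R) (f : R -> R) (z : R) : R :=
  (1 - alpha) * ln (1 + expR (- z)) + alpha * f z.

Definition global_min (R : realType) (V : Type) (F : V -> R) (v : V) : Prop :=
  forall u, F v <= F u.

Definition train_loss d (T : measurableType d) (R : realType)
    (P : probability T R) (n N : nat) (alpha : R) (f : R -> R)
    (muf sigmaf sigman : R) (D : 'I_N -> draw P n) (w : T)
    (S : 'cV[R]_n.+1) : R :=
  N%:R^-1 * \sum_(i < N)
    ell alpha f (label (D i) w * dotp S (sample muf sigmaf sigman (D i) w)).

(* A minimizer; it is 0 if there is none. *)
Definition S_min d (T : measurableType d) (R : realType)
    (P : probability T R) (n N : nat) (alpha : R) (f : R -> R)
    (muf sigmaf sigman : R) (D : 'I_N -> draw P n) (w : T) : 'cV[R]_n.+1 :=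
  xget 0 [set S | global_min (train_loss alpha f muf sigmaf sigman D w) S].

(* The fresh draw [D'] lives on its own probability space, hence the probability
   is taken with the training outcome [w] fixed. *)
Definition A_gen_min d d' (T : measurableType d) (T' : measurableType d')
    (R : realType) (P : probability T R) (P' : probability T' R) (n N : nat)
    (alpha : R) (f : R -> R) (muf sigmaf : R) (D : 'I_N -> draw P n)
    (D' : draw P' n) (w : T) (sigman : R) : \bar R :=
  accuracy muf sigmaf sigman D' (S_min alpha f muf sigmaf sigman D w).

(* Main.v *)
Require Import Defs.
From HB Require Import structures.
From mathcomp Require Import all_boot all_order all_algebra.
From mathcomp Require Import all_classical all_reals all_analysis.
From mathcomp Require Import measurable_realfun ring lra.
Import Order.TTheory GRing.Theory Num.Theory.
Import numFieldNormedType.Exports.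

(* Multiplying the perpendicular coordinates of S by sigman turns the loss, and
   the accuracy of S, for noise level sigman into those for noise level 1; so
   the minimizers for different sigman are rescalings of each other and have the
   same accuracy, as soon as the minimizer at noise level 1 is unique.
   Uniqueness and existence hold whenever the N x d data matrix is injective:
   ell is strictly convex (because of its softplus part) and has a minimizer,
   hence it grows at least linearly, and the loss inherits both properties.
   Injectivity is almost sure. The leading m+1 minor is an affine function of
   its corner entry, with the leading m minor as slope. For m > 0 that entry is
   a Gaussian independent of all other entries, so, where the slope is not zero,
   it hits the root with probability zero; induct on m. *)

Set Implicit Arguments.
Unset Strict Implicit.
Unset Printing Implicit Defensive.

Local Open Scope classical_set_scope.
Local Open Scope ring_scope.

(** * Convex functions on the line *)

Section ConvexReal.
Variable R : realType.
Implicit Types (h : R -> R) (x y z : R).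

Definition cvx h := forall t x y, 0 <= t -> t <= 1 ->
  h (t * x + (1 - t) * y) <= t * h x + (1 - t) * h y.

Lemma cvx_convex_function h :
  convex_function (E := R^o) [set: R^o] h -> cvx h.
Proof.
move=> hc t x y t0 t1.
have t01 : Itv.spec (@Itv.num_sem R) (Itv.Real `[0%Z, 1%Z]) t.
  by rewrite /Itv.spec /= /Itv.num_sem /= in_itv /= num_real t0 t1.
have := hc (Itv.mk t01) x y.
by rewrite !in_setT; exact.
Qed.

Lemma cvx_comb (a b : R) h1 h2 : 0 <= a -> 0 <= b -> cvx h1 -> cvx h2 ->
  cvx (fun z => a * h1 z + b * h2 z).
Proof.
move=> a0 b0 c1 c2 t x y t0 t1.
have := ler_wpM2l a0 (c1 t x y t0 t1).
have := ler_wpM2l b0 (c2 t x y t0 t1).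
lra.
Qed.

(** Convexity on the chords from [x] to [x + 1] and to [x - 1] bounds the increments at [x] above by
    [|s| * K]; since [x] is the midpoint of [x + s] and [x - s], the bound for [- s] gives the one
    from below. *)
Lemma cvx_continuous h : cvx h -> continuous h.
Proof.
move=> hc x.
pose K := `|h (x + 1) - h x| + `|h (x - 1) - h x|.
have up s : `|s| <= 1 -> h (x + s) - h x <= `|s| * K.
  move=> s1; have [s0|s0] := leP 0 s.
  - rewrite ger0_norm // in s1 *.
    have := hc s (x + 1) x s0 s1.
    rewrite (_ : s * (x + 1) + (1 - s) * x = x + s); last by ring.
    have := ler_wpM2l s0 (ler_norm (h (x + 1) - h x)).
    have := mulr_ge0 s0 (normr_ge0 (h (x - 1) - h x)).
    rewrite /K; lra.
  - rewrite ltr0_norm // in s1 *.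
    have s0' : 0 <= - s by lra.
    have := hc (- s) (x - 1) x s0' s1.
    rewrite (_ : - s * (x - 1) + (1 - - s) * x = x + s); last by ring.
    have := ler_wpM2l s0' (ler_norm (h (x - 1) - h x)).
    have := mulr_ge0 s0' (normr_ge0 (h (x + 1) - h x)).
    rewrite /K; lra.
have bound s : `|s| <= 1 -> `|h (x + s) - h x| <= `|s| * K.
  move=> s1; rewrite ler_norml up // andbT.
  have := up (- s); rewrite normrN => /(_ s1).
  have := hc (1 / 2) (x + s) (x - s) ltac:(lra) ltac:(lra).
  rewrite (_ : 1 / 2 * (x + s) + (1 - 1 / 2) * (x - s) = x); last by field.
  lra.
have K0 : 0 <= K by rewrite addr_ge0.
apply/cvgrPdist_le => e e0.
near=> y.
have ys : `|y - x| <= Num.min 1 (e / (K + 1)).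
  rewrite distrC; near: y.
  apply: (@cvgr_dist_le _ _ _ _ (nbhs_filter x) id x (@cvg_id _ _)).
  by rewrite lt_min ltr01 divr_gt0 // ltr_wpDl.
move: ys; rewrite le_min => /andP[y1 y2].
rewrite distrC (_ : y = x + (y - x)); last by ring.
apply: le_trans (bound _ y1) _.
have : `|y - x| * (K + 1) <= e by rewrite -ler_pdivlMr // ltr_wpDl.
have := normr_ge0 (y - x); lra.
Unshelve. all: by end_near. Qed.

(** The slope of [h] along a ray from [z0] does not decrease, so beyond distance 1 it is at least
    the slope to [z0 + 1] or [z0 - 1], which is positive by uniqueness. The [- 1] makes the bound
    trivial closer to [z0]. *)
Lemma cvx_coercive h z0 : cvx h -> global_min h z0 ->
  (forall z, global_min h z -> z = z0) ->
  exists2 m : R, 0 < m & forall z, m * (`|z - z0| - 1) <= h z - h z0.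
Proof.
move=> hc hmin huniq.
have lt z : z != z0 -> h z0 < h z.
  move=> zz0; rewrite lt_neqAle hmin andbT; apply: contra_neq zz0 => e.
  by apply: huniq => u; rewrite -e; exact: hmin.
have up : h z0 < h (z0 + 1).
  by apply: lt; rewrite -subr_eq0 addrC addKr oner_eq0.
have dn : h z0 < h (z0 - 1).
  by apply: lt; rewrite -subr_eq0 addrC addKr oppr_eq0 oner_eq0.
pose m := Num.min (h (z0 + 1) - h z0) (h (z0 - 1) - h z0).
have m0 : 0 < m by rewrite lt_min !subr_gt0 up dn.
exists m => // z.
have mup : m <= h (z0 + 1) - h z0 by rewrite /m ge_min lexx.
have mdn : m <= h (z0 - 1) - h z0 by rewrite /m ge_min lexx orbT.
have [near|far] := leP `|z - z0| 1.
  apply: (@le_trans _ _ 0); last by rewrite subr_ge0; exact: hmin.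
  by rewrite mulr_ge0_le0 ?(ltW m0) // subr_le0.
suff : m * `|z - z0| <= h z - h z0 by lra.
set r := `|z - z0| in far *.
have r0 : 0 < r by lra.
have rV0 : 0 <= r^-1 by rewrite invr_ge0 ltW.
have rV1 : r^-1 <= 1 by rewrite invf_le1 // ltW.
(* Used for [w] at distance 1 from [z0] towards [z]: this point has weight [r^-1] on [z]. *)
have key w : h w <= r^-1 * h z + (1 - r^-1) * h z0 ->
    m <= h w - h z0 -> m * r <= h z - h z0.
  move=> h1 h2; rewrite -ler_pdivlMr // mulrC; lra.
have rr : r^-1 * r = 1 by rewrite mulVf // gt_eqF.
have [s0|s0] := leP 0 (z - z0).
- apply: (key (z0 + 1)) mup.
  have := hc r^-1 z z0 rV0 rV1; congr (h _ <= _).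
  have -> : z = z0 + r by rewrite /r ger0_norm //; ring.
  by rewrite -[in RHS]rr; ring.
- apply: (key (z0 - 1)) mdn.
  have := hc r^-1 z z0 rV0 rV1; congr (h _ <= _).
  have -> : z = z0 - r by rewrite /r ltr0_norm //; ring.
  by rewrite -[in RHS]rr; ring.
Qed.

(* With p = e^-c / (1 + e^-c), convexity of exp gives
   e^(p (c - z)) <= p e^(c - z) + 1 - p = (1 + e^-z) / (1 + e^-c). *)
Lemma softplus_tangent c z :
  ln (1 + expR (- c)) - expR (- c) / (1 + expR (- c)) * (z - c)
    <= ln (1 + expR (- z)).
Proof.
set q := 1 + expR (- c).
have e0 := expR_gt0 (- c).
have q0 : 0 < q by rewrite /q; lra.
set p := expR (- c) / q.
have p0 : 0 <= p by rewrite divr_ge0 // ltW.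
have p1 : p <= 1 by rewrite ler_pdivrMr // mul1r /q; lra.
have t01 : Itv.spec (@Itv.num_sem R) (Itv.Real `[0%Z, 1%Z]) p.
  by rewrite /Itv.spec /= /Itv.num_sem /= in_itv /= num_real p0 p1.
have := convex_expR (Itv.mk t01) (c - z) 0.
rewrite !convRE /= mulr0 addr0 expR0 mulr1 => key.
rewrite -ler_expR lnK ?posrE; last by rewrite ltr_wpDl // expR_gt0.
rewrite expRD lnK ?posrE // -mulrN opprB.
apply: (le_trans (ler_wpM2l (ltW q0) key)).
rewrite /unstable.onem -[c]opprK expRD (expRN (- c)).
have eN0 := lt0r_neq0 e0; have qN0 := lt0r_neq0 q0.
have pq : p * q = expR (- c) by rewrite divfK.
have -> : q * (p * ((expR (- c))^-1 * expR (- z)) + (1 - p)) =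
    p * q * ((expR (- c))^-1 * expR (- z)) + (q - p * q) by ring.
rewrite pq mulVKf // /q; lra.
Qed.

(** In the average of the tangent bounds for the tangent at [c], evaluated at [x] and [y], the
    linear terms cancel. *)
Lemma cvx_softplus : cvx (fun z => ln (1 + expR (- z))).
Proof.
move=> t x y t0 t1; set c := t * x + (1 - t) * y.
have s0 : 0 <= 1 - t by lra.
have := ler_wpM2l t0 (softplus_tangent c x).
have := ler_wpM2l s0 (softplus_tangent c y).
set p := expR (- c) / _.
have : t * (p * (x - c)) + (1 - t) * (p * (y - c)) = 0 by rewrite /c; ring.
lra.
Qed.

(* With a = e^(-x/2) and b = e^(-y/2) this is
   (1 + a b)^2 < (1 + a^2) (1 + b^2). *)
Lemma softplus_strict_midpoint x y : x != y ->
  ln (1 + expR (- (2^-1 * (x + y))))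
    < 2^-1 * (ln (1 + expR (- x)) + ln (1 + expR (- y))).
Proof.
move=> xy.
pose a := expR (- (2^-1 * x)); pose b := expR (- (2^-1 * y)).
have a0 : 0 < a by exact: expR_gt0.
have b0 : 0 < b by exact: expR_gt0.
have ab : a != b.
  by apply: contra_neq xy => /expR_inj; lra.
have -> : expR (- (2^-1 * (x + y))) = a * b.
  by rewrite -expRD; congr expR; ring.
have -> : expR (- x) = a * a by rewrite -expRD; congr expR; field.
have -> : expR (- y) = b * b by rewrite -expRD; congr expR; field.
have ab0 := mulr_gt0 a0 b0; have aa0 := mulr_gt0 a0 a0.
have bb0 := mulr_gt0 b0 b0.
suff : ln (1 + a * b) + ln (1 + a * b) < ln (1 + a * a) + ln (1 + b * b).
  lra.
rewrite -!lnM ?posrE; try by lra.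
rewrite ltr_ln ?posrE; [|by apply: mulr_gt0; lra..].
have : 0 < (a - b) ^+ 2 by rewrite exprn_even_gt0 //= subr_eq0.
rewrite expr2; lra.
Qed.

End ConvexReal.

(** * Minimizers of the empirical risk *)

Section EmpiricalRisk.
Variable R : realType.

Definition strictly_midconvex (h : R -> R) := forall x y, x != y ->
  h (2^-1 * (x + y)) < 2^-1 * (h x + h y).

Lemma cvx_midpoint (h : R -> R) x y : cvx h ->
  h (2^-1 * (x + y)) <= 2^-1 * (h x + h y).
Proof.
move=> hc; have := hc 2^-1 x y ltac:(lra) ltac:(lra).
rewrite (_ : 2^-1 * x + _ = 2^-1 * (x + y)); last by field.
lra.
Qed.

Lemma cvx_ell (alpha : R) f : 0 <= alpha -> alpha <= 1 -> cvx f ->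
  cvx (ell alpha f).
Proof.
by move=> a0 a1 fc; apply: cvx_comb => //; [lra | exact: cvx_softplus].
Qed.

Lemma strictly_midconvex_ell (alpha : R) f : 0 <= alpha -> alpha < 1 -> cvx f ->
  strictly_midconvex (ell alpha f).
Proof.
move=> a0 a1 fc x y /softplus_strict_midpoint s.
have s0 : 0 < 1 - alpha by lra.
move: s; rewrite -(ltr_pM2l s0) => s.
have := ler_wpM2l a0 (cvx_midpoint x y fc); rewrite /ell; lra.
Qed.

(** Row [i] of [M] stands for sample [i] times its label, so that [M *m S] lists the margins. *)
Definition risk (N p : nat) (h : R -> R) (M : 'M[R]_(N, p)) (S : 'cV[R]_p) :=
  N%:R^-1 * \sum_(i < N) h ((M *m S) i 0).

(** Row vectors, because the compactness and extreme value results applied in [risk_unique_min] are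
    about them. *)
Lemma risk_continuous (N p : nat) (h : R -> R) (M : 'M[R]_(N, p)) :
  continuous h -> continuous (fun v : 'rV[R]_p => risk h M v^T).
Proof.
move=> hc.
have cM (a : R) (g : 'rV[R]_p -> R) : continuous g ->
    continuous (fun v => a * g v).
  by move=> gc v; apply: (@continuousM _ 'rV[R]_p (cst a) g v);
    [exact: cst_continuous | exact: gc].
apply: (cM); apply: continuous_big => [|i _]; first exact: add_continuous.
suff lin : continuous (fun v : 'rV[R]_p => (M *m v^T) i 0).
  by move=> v; apply: (@continuous_comp _ _ _ _ h v (lin v)); exact: hc.
under eq_fun do (rewrite mxE; under eq_bigr do rewrite mxE).
apply: continuous_big => [|j _]; first exact: add_continuous.
by apply: cM; exact: coord_continuous.
Qed.

(** Existence: comparison with 0 confines the margins [M *m S], and [L] carries this over to [S],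
    leaving a compact box. Uniqueness: distinct minimizers differ in some margin, as [M] is
    injective, so their midpoint would do strictly better. *)
Lemma risk_unique_min (N p : nat) (h : R -> R) (M : 'M[R]_(N, p))
    (L : 'M[R]_(p, N)) :
  (0 < N)%N -> L *m M = 1%:M -> cvx h -> strictly_midconvex h ->
  (exists! z, global_min h z) ->
  exists! S, global_min (risk h M) S.
Proof.
move=> N0 LM hc hs [z0 [hmin huniq]].
have NV0 : 0 < N%:R^-1 :> R by rewrite invr_gt0 ltr0n.
have [m m0 coer] := cvx_coercive hc hmin (fun z hz => esym (huniq z hz)).
(* If [S] is no worse than 0, the excesses over [h z0] at its margins sum to at most
   [N%:R * (h 0 - h z0)]. They are nonnegative, so each obeys this bound, and [coer] turns it into
   the bound [B] on the distance of a margin to [z0]. *)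
pose B := 1 + N%:R * (h 0 - h z0) / m.
have bound S : risk h M S <= risk h M 0 ->
    forall i, `|(M *m S) i 0| <= B + `|z0|.
  rewrite /risk ler_pM2l // mulmx0 => le i.
  have : \sum_(k < N) (h ((M *m S) k 0) - h z0) <= N%:R * (h 0 - h z0).
    rewrite sumrB sumr_const card_ord mulrBr !mulr_natl lerD2r.
    apply: le_trans le _; rewrite (eq_bigr (fun _ => h 0)); last first.
      by move=> k _; rewrite mxE.
    by rewrite sumr_const card_ord.
  rewrite (bigD1 i) //= => le'.
  have : h ((M *m S) i 0) - h z0 <= N%:R * (h 0 - h z0).
    apply: le_trans le'; rewrite lerDl; apply: sumr_ge0 => k _.
    by rewrite subr_ge0; exact: hmin.
  move/(le_trans (coer _)); rewrite mulrC -ler_pdivlMr // => le2.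
  rewrite -[X in `|X|](subrK z0); apply: le_trans (ler_normD _ _) _.
  by rewrite lerD2r /B; lra.
(* Summing over all rows of [L] gives one bound for every coordinate of [S]. *)
pose C := \sum_(i < p) \sum_(j < N) `|L i j| * (B + `|z0|).
have B0 : 0 <= B + `|z0|.
  by have := bound 0 (lexx _) (Ordinal N0); apply: le_trans.
have boundS S : risk h M S <= risk h M 0 -> forall k, `|S k 0| <= C.
  move=> le k; have -> : S = L *m (M *m S) by rewrite mulmxA LM mul1mx.
  rewrite mxE; apply: le_trans (ler_norm_sum _ _ _) _.
  rewrite /C (bigD1 k) //=; apply: ler_wpDr.
    by apply: sumr_ge0 => i _; apply: sumr_ge0 => j _; rewrite mulr_ge0.
  by apply: ler_sum => j _; rewrite normrM ler_wpM2l ?bound.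
pose K := [set v : 'rV[R]_p | forall i, `[- C, C]%classic (v ord0 i)].
have C0 : 0 <= C.
  by apply: sumr_ge0 => i _; apply: sumr_ge0 => j _; rewrite mulr_ge0.
have K0 : K 0 by move=> i; rewrite /= mxE in_itv /= oppr_le0 C0.
have [v vK vmin] : exists2 v, v \in K &
    forall u, u \in K -> risk h M v^T <= risk h M u^T.
  apply: (@EVT_min_rV _ _ (fun v => risk h M v^T)).
  - by exists 0.
  - by apply: (@rV_compact _ _ (fun=> `[- C, C]%classic)) => _;
      exact: segment_compact.
  - apply: continuous_subspaceT; apply: risk_continuous.
    exact: cvx_continuous.
have vmin0 : global_min (risk h M) v^T.
  move=> S; have [le|/ltW le] := leP (risk h M S) (risk h M 0).
    rewrite -[S]trmxK; apply: vmin; rewrite inE => i /=.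
    by rewrite in_itv /= mxE -ler_norml; exact: boundS.
  apply: le_trans le; rewrite -[0 in leRHS]trmxK trmx0.
  by apply: vmin; rewrite inE.
exists v^T; split=> // S Smin; apply/eqP/negPn/negP => vS.
have [i Mi] : exists i, (M *m v^T) i 0 != (M *m S) i 0.
  apply/existsP; apply: contra_neqT vS => /existsPn e.
  rewrite -[v^T]mul1mx -[S]mul1mx -LM -!mulmxA; congr (_ *m _).
  by apply/colP => i; apply/eqP/negPn/e.
have : risk h M (2^-1 *: (v^T + S)) < 2^-1 * (risk h M v^T + risk h M S).
  rewrite /risk -mulrDr mulrCA ltr_pM2l // -big_split mulr_sumr /=.
  rewrite [ltLHS](bigD1 i) // [ltRHS](bigD1 i) //=.
  have e k : (M *m (2^-1 *: (v^T + S))) k 0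
      = 2^-1 * ((M *m v^T) k 0 + (M *m S) k 0).
    by rewrite -scalemxAr mulmxDr !mxE.
  rewrite ltr_leD ?e ?hs //; apply: ler_sum => k _.
  by rewrite e; exact: cvx_midpoint.
have e : risk h M S = risk h M v^T by apply/le_anti; rewrite Smin vmin0.
have := vmin0 (2^-1 *: (v^T + S)).
rewrite e; lra.
Qed.

End EmpiricalRisk.

(** * Affine functions of an independent atomless variable *)

Section AffineNull.
Context d (T : measurableType d) (R : realType) (P : probability T R).

Lemma std_normal_atomless (X : {RV P >-> R}) (x : R) :
  std_normal X -> P (X @^-1` [set x]) = 0%E.
Proof.
move=> /(_ _ (measurable_set1 x)); rewrite /distribution /pushforward => ->.
exact: (null_content_dominatesP _ _).1 (@normal_prob_dominates R 0 1) _
  (measurable_set1 x) (lebesgue_measure_set1 x).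
Qed.

(* Under the product law of V and X the event has one-point sections. *)
Lemma affine_root_null d' (T' : measurableType d') (V : {mfun T >-> T'})
    (X : {RV P >-> R}) (Y Z : T' -> R) :
  (forall A B, measurable A -> measurable B ->
    P (V @^-1` A `&` X @^-1` B) = (P (V @^-1` A) * P (X @^-1` B))%E) ->
  (forall x, P (X @^-1` [set x]) = 0%E) ->
  measurable_fun setT Y -> measurable_fun setT Z ->
  P.-negligible [set w | X w * Y (V w) + Z (V w) = 0 /\ Y (V w) <> 0].
Proof.
move=> indep atom mY mZ.
pose E : set (T' * R) :=
  [set p | p.2 * Y p.1 + Z p.1 = 0] `&` [set p | Y p.1 <> 0].
have mY1 : measurable_fun [set: T' * R] (Y \o fst).
  exact: measurableT_comp.
have mE : measurable E.
  apply: measurableI.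
  - rewrite -[X in measurable X]setTI.
    have mF : measurable_fun [set: T' * R] (fun p => p.2 * Y p.1 + Z p.1).
      apply: measurable_funD; last exact: measurableT_comp.
      by apply: measurable_funM.
    exact: mF measurableT _ (measurable_set1 0).
  - rewrite -[X in measurable X]setTI.
    exact: mY1 measurableT _ (measurableC (measurable_set1 0)).
have mVX : measurable_fun setT (fun w => (V w, X w)).
  by apply: measurable_fun_pair.
pose VX : {mfun T >-> (T' * R)%type} :=
  HB.pack (fun w => (V w, X w)) (isMeasurableFun.Build _ _ _ _ _ mVX).
pose m' : probability (T' * R)%type R := distribution P VX.
pose m1 : probability T' R := distribution P V.
pose m2 : probability R R := distribution P X.
(* By independence the joint law agrees with the product on rectangles, hence everywhere. *)
have prodE : (m1 \x m2)%E E = m' E.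
  by apply: product_measure_unique mE => A B mA mB; exact: indep.
have nullE : m' E = 0%E.
  rewrite -prodE /product_measure1; apply: integral0_eq => v _ /=.
  have [Yv|Yv] := eqVneq (Y v) 0.
    rewrite (_ : xsection E v = set0) ?measure0 //.
    by rewrite -subset0 => x; rewrite /xsection /= inE => -[_] /=; rewrite Yv.
  apply/eqP; rewrite eq_le measure_ge0 andbT -(atom (- Z v / Y v)).
  have mv := measurable_xsection v mE.
  apply: (@le_measure _ _ _ m2); rewrite ?inE //.
  move=> x; rewrite /xsection /= inE => -[/= h _].
  apply: (mulIf Yv); rewrite divfK //.
  by apply/eqP; rewrite -addr_eq0 h.
exists (VX @^-1` E); split => //.
by rewrite -[X in measurable X]setTI; exact: (mVX measurableT _ mE).
Qed.

End AffineNull.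

(** * Independence of one variable from all the others *)

Section OtherVariables.
Context d (T : measurableType d) (R : realType) (P : probability T R).
Variables (K : finType) (X : K -> {RV P >-> R}).

Definition cylinder (k : K) (A : K -> set R) : set T :=
  [set w | forall i, i != k -> A i (X i w)].

Definition other_cylinders (k : K) : set (set T) :=
  [set cylinder k A | A in [set A | forall i, measurable (A i)]].

Lemma measurable_all_in (A : K -> set R) : (forall i, measurable (A i)) ->
  measurable [set w | forall i, A i (X i w)].
Proof.
move=> mA.
rewrite (_ : mkset _ = \bigcap_(i in [set: K]) (X i @^-1` A i)); last first.
  by apply/seteqP; split => [w h i _|w h i]; [exact: h | exact: (h i I)].
apply: fin_bigcap_measurable => [|i _]; first exact: finite_finset.
exact: measurable_funPTI.
Qed.

Lemma cylinderE k A :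
  cylinder k A = [set w | forall i, (if i == k then setT else A i) (X i w)].
Proof.
by apply/seteqP; split => w h i; have := h i; case: eqP => // _; exact.
Qed.

Lemma other_cylinders_measurable k : other_cylinders k `<=` measurable.
Proof.
move=> _ [A mA <-]; rewrite cylinderE.
apply: (measurable_all_in (A := fun i => if i == k then setT else A i)) => i.
by case: eqP.
Qed.

Lemma other_cylinders_setI k : setI_closed (other_cylinders k).
Proof.
move=> _ _ [A mA <-] [B mB <-]; exists (fun i => A i `&` B i).
  by move=> i; exact: measurableI.
by apply/seteqP; split => [w h|w [hA hB] i ik]; split;
  [move=> i /h [] | move=> i /h [] | exact: hA | exact: hB].
Qed.

(** The carrier is still [T], with the coarser sigma-algebra generated by the [X i] for [i != k];
    measurability here expresses that a function on [T] depends on those variables only. *)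
Definition others (k : K) := g_sigma_algebraType (other_cylinders k).

Lemma measurable_others k i : i != k ->
  measurable_fun [set: others k] (X i : others k -> R).
Proof.
move=> ik _ B mB; rewrite setTI; apply: sub_sigma_algebra.
exists (fun j => if j == i then B else setT); first by move=> j; case: eqP.
apply/seteqP; split => [w /(_ i ik)|w h j jk]; first by rewrite eqxx.
by case: eqP => // ->.
Qed.

Lemma measurable_to_others k : measurable_fun [set: T] (id : T -> others k).
Proof.
move=> _ B mB; rewrite setTI preimage_id.
exact: (smallest_sub (@sigma_algebra_measurable _ T)
  (@other_cylinders_measurable k)).
Qed.

Hypothesis indep : mutually_independent X.

(** Both sides are finite measures in [A] that agree on the cylinders, a generating pi-system, hence
    on the whole sigma-algebra. *)
Lemma indep_others k (A : set T) (B : set R) :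
  <<s other_cylinders k >> A -> measurable B ->
  P (A `&` X k @^-1` B) = (P A * P (X k @^-1` B))%E.
Proof.
move=> mA mB.
have mXB : measurable (X k @^-1` B) by exact: measurable_funPTI.
have r0 : 0 <= fine (P (X k @^-1` B)) by exact: fine_ge0.
rewrite muleC -[P (X k @^-1` B)]fineK; last exact: fin_num_measure.
(* The two sides as measures in [A]: a restriction of [P] and a multiple of [P]. *)
transitivity (mrestr P mXB A) => //.
transitivity (mscale (NngNum r0) P A) => //.
apply: (@g_sigma_algebra_measure_unique _ _ _ (other_cylinders k)
  (@other_cylinders_measurable k) (fun=> setT)) => //.
- move=> _; exists (fun=> setT) => //.
  by apply/seteqP; split.
- by rewrite bigcup_const //; exists 0%N.
- exact: other_cylinders_setI.
- move=> _ [C mC <-]; change (P (cylinder k C `&` X k @^-1` B) =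
    (fine (P (X k @^-1` B)))%:E * P (cylinder k C))%E.
  rewrite fineK ?fin_num_measure //.
  (* The two products given by independence share all factors off [k]; at [k] one has [B] and the
     other [setT]. *)
  pose C1 i := if i == k then B else C i.
  pose C2 i := if i == k then setT else C i.
  have -> : cylinder k C `&` X k @^-1` B = [set w | forall i, C1 i (X i w)].
    apply/seteqP; split => [w [hC hB] i|w h].
      by rewrite /C1; case: eqVneq => [->//|]; exact: hC.
    split; last by have := h k; rewrite /C1 eqxx.
    by move=> i ik; have := h i; rewrite /C1 (negbTE ik).
  rewrite cylinderE -/(C2 _).
  rewrite indep; last by move=> i; rewrite /C1; case: eqP.
  rewrite (indep (A := C2)); last by move=> i; rewrite /C2; case: eqP.
  rewrite (bigD1 k) //= [in RHS](bigD1 k) //= /C1 /C2 eqxx.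
  rewrite preimage_setT probability_setT mul1e; congr (_ * _)%E.
  by apply: eq_bigr => i /negbTE ->.
- move=> _; change (P (setT `&` X k @^-1` B) < +oo)%E.
  by rewrite setTI ltey_eq fin_num_measure.
Qed.

(** Here [V] is the identity of [T], read as a map into the coarser sigma-algebra; it is independent
    of [X k] by [indep_others]. *)
Lemma affine_others_null k (Y Z : T -> R) :
  (forall x, P (X k @^-1` [set x]) = 0%E) ->
  measurable_fun [set: others k] (Y : others k -> R) ->
  measurable_fun [set: others k] (Z : others k -> R) ->
  P.-negligible [set w | X k w * Y w + Z w = 0 /\ Y w <> 0].
Proof.
move=> atom mY mZ.
pose V : {mfun T >-> others k} :=
  HB.pack (id : T -> others k)
    (isMeasurableFun.Build _ _ _ _ _ (@measurable_to_others k)).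
apply: (@affine_root_null _ _ _ P _ _ V (X k) Y Z) => // A B mA mB.
exact: indep_others.
Qed.

End OtherVariables.

(** * Leading minors of random matrices *)

Section LeadingMinors.
Variable R : realType.

(** Indexing by [nat] lets the minors of all sizes share one array. *)
Definition leading_minor (T : Type) (a : nat -> nat -> T -> R) (m : nat)
    (w : T) :=
  \det (\matrix_(i < m, j < m) a i j w).

Lemma measurable_leading_minor d (U : measurableType d)
    (a : nat -> nat -> U -> R) (m : nat) :
  (forall i j, (i < m)%N -> (j < m)%N -> measurable_fun setT (a i j)) ->
  measurable_fun setT (leading_minor a m).
Proof.
move=> ma; rewrite /leading_minor /determinant; apply: measurable_sum => s.
apply: measurable_funM => //; apply: measurable_prod => i _.
by under eq_fun do rewrite mxE; exact: ma.
Qed.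

Definition erase_corner (T : Type) (a : nat -> nat -> T -> R) (m i j : nat) :=
  if (i == m) && (j == m) then cst 0 else a i j.

(* Expansion along the last row: no cofactor of that row involves the corner
   entry. *)
Lemma leading_minorS (T : Type) (a : nat -> nat -> T -> R) (m : nat) (w : T) :
  leading_minor a m.+1 w =
  a m m w * leading_minor a m w + leading_minor (erase_corner a m) m.+1 w.
Proof.
rewrite /leading_minor (expand_det_row _ ord_max).
rewrite [in RHS](expand_det_row _ ord_max).
rewrite (bigD1 ord_max) //= [in RHS](bigD1 ord_max) //= !mxE.
rewrite /erase_corner eqxx /=.
rewrite mul0r add0r; congr (_ * _ + _).
  rewrite /cofactor -signr_odd /= addnn odd_double expr0 mul1r.
  congr (\det _); apply/matrixP => i j; rewrite !mxE.
  by rewrite !lift_max.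
apply: eq_bigr => j jm; rewrite !mxE eqxx /=.
have /negbTE -> : (j != m :> nat) by [].
congr (_ * (_ * \det _)); apply/matrixP => i k; rewrite !mxE.
by rewrite !lift_max /= (ltn_eqF (ltn_ord i)).
Qed.

(** The entry [a 0 0] has a hypothesis of its own: in the application it combines label and feature
    noise, whereas every later diagonal entry is a single variable. *)
Lemma leading_minor_null d (T : measurableType d) (P : probability T R)
    (K : finType) (X : K -> {RV P >-> R}) (a : nat -> nat -> T -> R) (p : nat) :
  mutually_independent X ->
  P.-negligible [set w | a 0 0 w = 0] ->
  (forall m, (0 < m)%N -> (m < p)%N -> exists k,
    [/\ forall x, P (X k @^-1` [set x]) = 0%E,
        a m m = X k &
        forall i j, (i <= m)%N -> (j <= m)%N -> (i != m) || (j != m) ->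
          measurable_fun [set: others X k] (a i j : others X k -> R)]) ->
  forall m, (m <= p)%N -> P.-negligible [set w | leading_minor a m w = 0].
Proof.
move=> indep a00 hp; elim=> [|m IH] mp.
  apply: (negligibleS _ (negligible_set0 _)) => w /=.
  by rewrite /leading_minor det_mx00 => /eqP; rewrite oner_eq0.
have [->|m0] := posnP m.
  apply: negligibleS a00 => w /=.
  by rewrite /leading_minor det_mx11 mxE.
have [k [atom amm ma]] := hp m m0 mp.
apply: negligibleS (negligibleU (IH (ltnW mp)) (affine_others_null indep
  (Y := leading_minor a m) (Z := leading_minor (erase_corner a m) m.+1)
  atom _ _)).
- move=> w /=; rewrite leading_minorS amm => e.
  by have [/eqP ?|/eqP ?] := boolP (leading_minor a m w == 0); [left|right].
- apply: (@measurable_leading_minor _ (others X k)) => i j im jm.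
  by apply: ma; [exact: ltnW | exact: ltnW | rewrite ltn_eqF].
- apply: (@measurable_leading_minor _ (others X k)) => i j im jm.
  rewrite /erase_corner; case: ifPn => [_|]; first exact: measurable_cst.
  by rewrite negb_and => ij; apply: ma.
Qed.

End LeadingMinors.

(** * The signal-plus-noise model *)

Section Sample.
Variables (d : measure_display) (T : measurableType d) (R : realType).
Variables (P : probability T R) (n : nat).
Implicit Types (D : draw P n) (S : 'cV[R]_n.+1).

Lemma sampleE muf sigmaf sigman D w k :
  sample muf sigmaf sigman D w k 0 =
  if unlift ord0 k is Some j then sigman * perp_noise D j w
  else label D w * muf + sigmaf * feat_noise D w.
Proof.
rewrite /sample !mxE; case: unliftP => [j ->|->] /=.
  by rewrite !mulr0 !add0r.
by rewrite !mulr1 mulr0 addr0.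
Qed.

(** The change of variables that moves the noise level from the samples into [S]. *)
Definition scale_perp (c : R) S : 'cV[R]_n.+1 :=
  \col_k (if k == 0 then S k 0 else c * S k 0).

Lemma scale_perpK c : c != 0 -> cancel (scale_perp c) (scale_perp c^-1).
Proof.
move=> c0 S; apply/colP => k; rewrite !mxE; case: (k == 0) => //.
by rewrite mulKf.
Qed.

Lemma dotpE S (x : 'cV[R]_n.+1) : dotp S x = \sum_k S k 0 * x k 0.
Proof. by rewrite /dotp mxE; apply: eq_bigr => k _; rewrite mxE. Qed.

Lemma dotp_sample muf sigmaf sigman D w S :
  dotp S (sample muf sigmaf sigman D w) =
  dotp (scale_perp sigman S) (sample muf sigmaf 1 D w).
Proof.
rewrite !dotpE; apply: eq_bigr => k _; rewrite !sampleE mxE.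
case: unliftP => [j ->|->]; last by rewrite eqxx.
by rewrite -[_ == 0]/false mul1r mulrCA mulrA.
Qed.

Lemma accuracy_scale muf sigmaf sigman D S :
  accuracy muf sigmaf sigman D S =
  accuracy muf sigmaf 1 D (scale_perp sigman S).
Proof.
rewrite /accuracy; congr (P _).
by apply/funext => w /=; rewrite dotp_sample.
Qed.

Lemma train_loss_scale N alpha f muf sigmaf sigman (D : 'I_N -> draw P n) w S :
  train_loss alpha f muf sigmaf sigman D w S =
  train_loss alpha f muf sigmaf 1 D w (scale_perp sigman S).
Proof.
rewrite /train_loss; congr (_ * _).
by apply: eq_bigr => i _; rewrite dotp_sample.
Qed.

Lemma global_min_scale N alpha f muf sigmaf sigman (D : 'I_N -> draw P n) w S :
  sigman != 0 ->
  global_min (train_loss alpha f muf sigmaf sigman D w) S <->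
  global_min (train_loss alpha f muf sigmaf 1 D w) (scale_perp sigman S).
Proof.
move=> s0; split => Smin S'; last by rewrite !(train_loss_scale _ _ _ _ sigman).
have sV0 : sigman^-1 != 0 by rewrite invr_eq0.
(* Every competitor is a rescaled vector, so rescaled competitors suffice. *)
have -> : S' = scale_perp sigman (scale_perp sigman^-1 S').
  by rewrite -{1}[sigman]invrK scale_perpK.
by rewrite -!train_loss_scale.
Qed.

Definition design muf sigmaf N (D : 'I_N -> draw P n) w : 'M[R]_(N, n.+1) :=
  \matrix_(i, k) (label (D i) w * sample muf sigmaf 1 (D i) w k 0).

Lemma train_loss_risk N alpha f muf sigmaf (D : 'I_N -> draw P n) w :
  train_loss alpha f muf sigmaf 1 D w =
  risk (ell alpha f) (design muf sigmaf D w).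
Proof.
apply/funext => S; rewrite /train_loss /risk; congr (_ * _).
apply: eq_bigr => i _; congr (ell _ _ _).
rewrite dotpE mulr_sumr mxE; apply: eq_bigr => k _.
by rewrite [design _ _ _ _ _ _]mxE mulrCA mulrC.
Qed.

End Sample.

(** * Almost sure full column rank of the design matrix *)

Lemma left_inverse_of_minor (F : fieldType) (N p : nat) (M : 'M[F]_(N, p))
    (g : 'I_p -> 'I_N) :
  \det (rowsub g M) != 0 -> exists L, L *m M = 1%:M.
Proof.
move=> dM; exists (invmx (rowsub g M) *m rowsub g 1%:M).
by rewrite -mulmxA mul_rowsub_mx mul1mx mulVmx // unitmxE unitfE.
Qed.

Section FullRank.
Variables (d : measure_display) (T : measurableType d) (R : realType).
Variables (P : probability T R) (n N : nat) (D : 'I_N -> draw P n).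
Variables (muf sigmaf : R) (i0 : 'I_N).

(* Indices are natural numbers to fit [leading_minor]; out of range they are
   sent to [i0] and [0]. *)
Let entry (i j : nat) (w : T) : R :=
  sample muf sigmaf 1 (D (insubd i0 i)) w (inord j) 0.

Let var (ik : 'I_N * (bool + 'I_n)) : {RV P >-> R} := draw_var (D ik.1) ik.2.

Lemma entry0 i :
  entry i 0 = fun w => label (D (insubd i0 i)) w * muf
                       + sigmaf * feat_noise (D (insubd i0 i)) w.
Proof.
apply/funext => w; rewrite /entry sampleE.
rewrite (_ : inord 0 = ord0) ?unlift_none //.
by apply/val_inj; rewrite /= inordK.
Qed.

Lemma entryS i (j : 'I_n) :
  entry i j.+1 = perp_noise (D (insubd i0 i)) j.
Proof.
apply/funext => w; rewrite /entry sampleE.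
rewrite (_ : inord j.+1 = lift ord0 j) ?liftK ?mul1r //.
by apply/val_inj; rewrite /= inordK // ltnS.
Qed.

Hypothesis hD : model_draws D.

(** If [sigmaf] is zero the entry is [muf] up to sign; otherwise it is affine in the feature noise
    with slope [sigmaf]. *)
Lemma entry00_null : 0 < muf -> P.-negligible [set w | entry 0 0 w = 0].
Proof.
case: hD => lab1 featN _ indep muf0; rewrite entry0.
set D0 := D _.
have [->|s0] := eqVneq sigmaf 0.
  apply: (negligibleS _ (negligible_set0 _)) => w /=.
  rewrite mul0r addr0 => /eqP; rewrite mulf_eq0 (gt_eqF muf0) orbF.
  by case: (lab1 (insubd i0 0) w) => ->; rewrite ?oppr_eq0 oner_eq0.
apply: negligibleS (affine_others_null (k := (insubd i0 0%N, inl false)) indep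
  (Y := cst sigmaf) (Z := fun w => label D0 w * muf) _ _ _).
- by move=> w /= e; split; [rewrite mulrC addrC | exact/eqP].
- by move=> x; exact/std_normal_atomless/featN.
- exact: measurable_cst.
- apply: measurable_funM => //.
  apply: (@measurable_others _ _ _ _ _ var _ (insubd i0 0%N, inl true)).
  by rewrite xpair_eqE andbF.
Qed.

Lemma entry_leading_minor_null : 0 < muf -> (n < N)%N ->
  P.-negligible [set w | leading_minor entry n.+1 w = 0].
Proof.
move=> muf0 nN; case: (hD) => _ _ perpN indep.
apply: (leading_minor_null (p := n.+1) indep (entry00_null muf0)) => //.
(* Column 0 holds the feature, so diagonal entry [m.+1] is perpendicular coordinate [m] of sample
   [m.+1]. *)
case=> // m _ mn; pose jm := Ordinal (mn : (m < n)%N).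
exists (insubd i0 m.+1, inr jm); split.
- by move=> x; exact/std_normal_atomless/perpN.
- by rewrite -[m]/(nat_of_ord jm) entryS.
move=> i j im jm' ij.
(* Row indices up to [m.+1] are below [N], so [insubd] does not fall back on [i0] and distinct rows
   come from distinct samples. *)
have lt k : (k <= m.+1)%N -> (k < N)%N.
  by move=> km; apply: leq_ltn_trans nN; apply: leq_trans km _.
have insub_eq : i != m.+1 -> insubd i0 i != insubd i0 m.+1.
  by apply: contra_neq => /(congr1 val); rewrite !val_insubd !lt.
have mvar k : k != (insubd i0 m.+1, inr jm) ->
    measurable_fun [set: others var (insubd i0 m.+1, inr jm)] (var k : T -> R).
  exact: measurable_others.
case: j => [|j] in jm' ij *.
  rewrite entry0; apply: measurable_funD; apply: measurable_funM => //.
  - by apply: (mvar (insubd i0 i, inl true)); rewrite xpair_eqE andbF.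
  - by apply: (mvar (insubd i0 i, inl false)); rewrite xpair_eqE andbF.
have jn : (j < n)%N by exact: leq_trans jm' mn.
rewrite -[j]/(nat_of_ord (Ordinal jn)) entryS.
apply: (mvar (insubd i0 i, inr (Ordinal jn))).
rewrite xpair_eqE negb_and; case/orP: ij => [/insub_eq ->//|].
by rewrite eqSS => jm0; apply/orP; right.
Qed.

(** The labels, left out of [entry] so that the entries off column 0 are single variables, return as
    a diagonal factor with nonzero determinant. *)
Lemma design_left_inverse : 0 < muf -> (n < N)%N ->
  {ae P, forall w, exists L, L *m design muf sigmaf D w = 1%:M}.
Proof.
move=> muf0 nN; case: (hD) => lab1 _ _ _.
apply: negligibleS (entry_leading_minor_null muf0 nN) => w /= noL.
apply/eqP/negPn/negP => minor0; apply: noL.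
pose g (i : 'I_n.+1) : 'I_N := insubd i0 (i : nat).
apply: (@left_inverse_of_minor _ _ _ _ g).
have -> : rowsub g (design muf sigmaf D w) =
    diag_mx (\row_i label (D (g i)) w) *m
    \matrix_(i < n.+1, j < n.+1) entry i j w.
  apply/matrixP => i j; rewrite mul_diag_mx /design.
  rewrite [LHS]mxE [LHS]mxE [RHS]mxE [in X in _ = X * _]mxE.
  by rewrite [in X in _ = _ * X]mxE /entry inord_val.
rewrite det_mulmx det_diag mulf_neq0 //.
apply/prodf_neq0 => i _; rewrite mxE.
by case: (lab1 (g i) w) => ->; rewrite ?oppr_eq0 oner_eq0.
Qed.

End FullRank.

Theorem proposition6p1 (R : realType)
    (d : measure_display) (T : measurableType d) (P : probability T R)
    (d' : measure_display) (T' : measurableType d') (P' : probability T' R)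
    (n N : nat) (alpha muf sigmaf : R) (f : R -> R)
    (D : 'I_N -> draw P n) (D' : draw P' n)
    (hN : (0 < N)%N) (hlambda : n.+1%:R / N%:R < 1 :> R)
    (halpha0 : 0 < alpha) (halpha1 : alpha < 1)
    (hmuf : 0 < muf) (hsigmaf : 0 <= sigmaf)
    (fconvex : convex_function (E := R^o) [set: R^o] f)
    (feven : forall z, f (- z) = f z)
    (hell : exists! zstar : R, global_min (ell alpha f) zstar)
    (hD : model_draws D) (hD' : model_draws (fun _ : unit => D')) :
  {ae P, forall w,
    (forall sigman : R, 0 < sigman ->
       exists! S, global_min (train_loss alpha f muf sigmaf sigman D w) S) /\
    (exists c : \bar R, forall sigman : R, 0 < sigman ->
       A_gen_min alpha f muf sigmaf D D' w sigman = c)}.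
Proof.
(* The dimension is [n.+1], so this provides at least as many samples as coordinates. *)
have nN : (n < N)%N.
  by move: hlambda; rewrite ltr_pdivrMr ?ltr0n // mul1r ltr_nat => /ltnW.
have fc := cvx_convex_function fconvex.
have ae := design_left_inverse sigmaf (Ordinal hN) hD hmuf nN.
apply: filterS ae => w [L LM].
have [S1 [S1min S1uniq]] := risk_unique_min hN LM
  (cvx_ell (ltW halpha0) (ltW halpha1) fc)
  (strictly_midconvex_ell (ltW halpha0) halpha1 fc) hell.
rewrite -train_loss_risk in S1min S1uniq.
(* The minimizer at [sigman] is [S1] with its perpendicular coordinates divided by [sigman]. *)
have uniq sigman : 0 < sigman ->
    unique (global_min (train_loss alpha f muf sigmaf sigman D w))
      (scale_perp sigman^-1 S1).
  move=> s0; have sN0 := lt0r_neq0 s0; split.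
    apply/global_min_scale => //.
    by rewrite -{1}[sigman]invrK scale_perpK // invr_eq0.
  move=> S /(global_min_scale _ _ _ _ _ _ _ sN0)/S1uniq ->.
  by rewrite scale_perpK.
split; first by move=> sigman /uniq; eexists; eassumption.
exists (accuracy muf sigmaf 1 D' S1) => sigman s0.
have [Smin Suniq] := uniq _ s0; have sN0 := lt0r_neq0 s0.
(* By uniqueness [S_min] can only choose this minimizer; scaling it back gives [S1], which does not
   involve [sigman]. *)
rewrite /A_gen_min /S_min (xget_unique _ Smin); last by move=> S /Suniq.
by rewrite accuracy_scale -{1}[sigman]invrK scale_perpK // invr_eq0.
Qed.
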